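(* Let $\kappa=0$ and let $A\in C^0(\mathbb{R},\mathrm{SL}(2,\mathbb{R}))\cap C^2(\mathbb{R},\mathbb{M}^2)$ be a solution of $\ddot A(t)=\lambda(t)\,\mathrm{cof}\,A(t)$ with initial data $(A(0),\dot A(0))=(A_0,B_0)\in\mathcal{D}$. If $|A(t)|^2\nearrow\infty$ as $t\to\infty$, then there exist $A_\infty,B_\infty\in\mathbb{M}^2$ with $B_\infty\ne0$ such that for $t>0$ and $j=0,1,2$, $$\left|\left(\tfrac{d}{dt}\right)^j\left[A(t)-(B_\infty t+A_\infty)\right]\right|\lesssim(1+t)^{-1-j}.$$ If $\bar A_\infty,\bar B_\infty\in\mathbb{M}^2$ is any pair such that $$\lim_{t\to\infty}|A(t)-(\bar B_\infty t+\bar A_\infty)|=0,$$ then $(\bar A_\infty,\bar B_\infty)=(A_\infty,B_\infty)$. The vectors $A_\infty,B_\infty$ satisfy $$X_i(A_\infty,B_\infty)=X_i(A_0,B_0)\equiv X_i,\quad i=1,2,3,$$ and $$\langle B_\infty,\mathrm{cof}\,A_\infty\rangle=\det B_\infty=0,\qquad \det A_\infty=\frac{X_3^2-X_2^2}{2X_1}.$$ If $2X_1+X_2^2-X_3^2=0$, then $(A_\infty,B_\infty)=(A_0,B_0)\in\mathcal{D}$ and $A(t)=B_0t+A_0$.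
   Context: $\mathbb{M}^2$ is the space of real $2\times2$ matrices with inner product $\langle A,B\rangle=\mathrm{tr}(A^\top B)$ and norm $|A|=\langle A,A\rangle^{1/2}$. $\mathrm{SL}(2,\mathbb{R})=\{A:\det A=1\}$. $Z=\begin{bmatrix}0&-1\\1&0\end{bmatrix}$ and $\mathrm{cof}\,A=ZAZ^\top$ is the cofactor matrix. $\mathcal{D}=\{(A,B)\in\mathbb{M}^2\times\mathbb{M}^2:\det A=1,\ \langle B,\mathrm{cof}\,A\rangle=0\}$ is the tangent bundle of $\mathrm{SL}(2,\mathbb{R})$. With $\kappa=0$, $$X_1(A,B)=\tfrac12|B|^2,\quad X_2(A,B)=\tfrac12\langle ZA-AZ,B\rangle,\quad X_3(A,B)=\tfrac12\langle ZA+AZ,B\rangle.$$ A solution means that the equation holds for some $\lambda\in C^0(\mathbb{R},\mathbb{R})$ (necessarily $\lambda(t)=-2\det\dot A(t)/|A(t)|^2$). $|A(t)|^2\nearrow\infty$ as $t\to\infty$ means that $|A(t)|^2\to\infty$, monotonically increasing for large $t$. $f(t)\lesssim h(t)$ means $f(t)\le Ch(t)$ with $C$ independent of $t$. *)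

(* Defs.v *)
From HB Require Import structures.
From mathcomp Require Import all_boot all_order all_algebra.
From mathcomp Require Import all_classical all_reals all_analysis.

Set Implicit Arguments.
Unset Strict Implicit.
Unset Printing Implicit Defensive.

Import Order.TTheory GRing.Theory Num.Theory.
Import numFieldNormedType.Exports.

Local Open Scope classical_set_scope.
Local Open Scope ring_scope.

(* On 'M[R]_2 the library norm `|A| is the max norm, which induces the same
   topology (hence the same limits and derivatives) as the Frobenius norm
   [frob_norm]. *)
Definition inner (R : realType) (A B : 'M[R]_2) : R := \tr (A^T *m B).

Definition frob_norm (R : realType) (A : 'M[R]_2) : R :=
  Num.sqrt (inner A A).

Definition SL2 (R : realType) : set 'M[R]_2 := [set A | \det A = 1].

(* Z = [0, -1; 1, 0] *)
Definition Zmx (R : realType) : 'M[R]_2 := delta_mx 1 0 - delta_mx 0 1.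

Definition cof (R : realType) (A : 'M[R]_2) : 'M[R]_2 :=
  Zmx R *m A *m (Zmx R)^T.

Definition TSL2 (R : realType) : set ('M[R]_2 * 'M[R]_2) :=
  [set p | \det p.1 = 1 /\ inner p.2 (cof p.1) = 0].

(* X1, X2, X3 are the invariants for kappa = 0, where X1 does not depend on A. *)
Definition X1 (R : realType) (A B : 'M[R]_2) : R := 2^-1 * frob_norm B ^+ 2.

Definition X2 (R : realType) (A B : 'M[R]_2) : R :=
  2^-1 * inner (Zmx R *m A - A *m Zmx R) B.

Definition X3 (R : realType) (A B : 'M[R]_2) : R :=
  2^-1 * inner (Zmx R *m A + A *m Zmx R) B.

Definition class_C (R : realType) (V : normedModType R) (k : nat)
    (f : R -> V) : Prop :=
  (forall j, (j < k)%N -> forall t : R, derivable f^`(j)%classic t 1) /\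
  (forall j, (j <= k)%N -> continuous f^`(j)%classic).

Definition is_solution (R : realType) (A : R -> 'M[R]_2) : Prop :=
  [/\ forall t, SL2 (A t),
      class_C 2 A &
      exists lam : R -> R, continuous lam /\
        forall t, A^`(2)%classic t = lam t *: cof (A t)].

(* Monotonicity is only required for large t, and is not strict. *)
Definition increases_to_infinity (R : realType) (f : R -> R) : Prop :=
  f t @[t --> +oo] --> +oo /\
  exists T : R, forall s t : R, T <= s -> s <= t -> f s <= f t.

Definition lesssim_pos (R : realType) (f h : R -> R) : Prop :=
  exists C : R, forall t : R, 0 < t -> f t <= C * h t.

(* Main.v *)
Require Import Defs.
From HB Require Import structures.
From mathcomp Require Import all_boot all_order all_algebra.
From mathcomp Require Import all_classical all_reals all_analysis.
From mathcomp Require Import ring lra.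

Set Implicit Arguments.
Unset Strict Implicit.
Unset Printing Implicit Defensive.

Import Order.TTheory GRing.Theory Num.Theory.
Import numFieldNormedType.Exports.

Local Open Scope classical_set_scope.
Local Open Scope ring_scope.

(** Along a solution, differentiating [\det A = 1] twice determines the
multiplier: [lam * |A|^2 = - 2 * \det A']. The energy [X1] and the two angular
momenta [X2], [X3] are conserved, and the polynomial identity

  [|A|^2 * \det B = X3^2 - X2^2 - 2 * \det A * X1 + <B, cof A> * <A, B>]

(lemma [frob_norm_sqr_det]) shows that [|A|^2 * \det A'] is a constant [k] of
the motion. Hence [lam = - 2 * k / |A|^4], and the acceleration [lam *: cof A]
has norm [2 * |k| / |A|^3].

The energy is positive, since otherwise [A] would be constant. The second
derivative of [|A|^2] is [4 * X1 + 4 * lam], which tends to [4 * X1 > 0] as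
[|A|^2] tends to infinity, so [|A|^2] grows at least quadratically
([solution_quadratic_growth]) and the acceleration is [O((1 + t)^-3)]
([solution_acceleration_decay]). Two integrations, entry by entry, give the
asymptotic line [t *: Binf + Ainf] with its rates ([affine_asymptotics],
[solution_asymptotic_line]).

Apart from the value of [\det Ainf], the relations between [Ainf] and [Binf]
are limits of relations along the motion. The velocity tends to [Binf], which gives [X1], and [\det A' = k / |A|^2] gives [\det Binf = 0]. The
quantities [X2], [X3] and [<A', cof A>] are pairings [<l A, A'>], with [l]
linear and [<l Binf, Binf> = 0]; for these the growth of [A] is invisible and
the limit is [<l Ainf, Binf>] ([cvg_bilinear_affine]). The value of
[\det Ainf] cannot be found by letting [t] tend to infinity in [\det A = 1],
where the [O(1 / t)] remainder is multiplied by [t]; it is read off from the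
polynomial identity at [(Ainf, Binf)].

The condition [2 * X1 + X2^2 - X3^2 = 0] says that [k = 0]: the acceleration
vanishes and the motion is uniform ([solution_free]). *)

(** * The bilinear algebra of 2 x 2 matrices *)

Lemma ord2P (i : 'I_2) : i = 0 \/ i = 1.
Proof. by case: i => [[|[|//]] ?]; [left | right]; apply/val_inj. Qed.

Lemma mx22P (R : realType) (A B : 'M[R]_2) :
  A 0 0 = B 0 0 -> A 0 1 = B 0 1 -> A 1 0 = B 1 0 -> A 1 1 = B 1 1 -> A = B.
Proof.
by move=> *; apply/matrixP => i j; case: (ord2P i) => ->; case: (ord2P j) => ->.
Qed.

Lemma innerE (R : realType) (A B : 'M[R]_2) :
  inner A B = A 0 0 * B 0 0 + A 0 1 * B 0 1 + A 1 0 * B 1 0 + A 1 1 * B 1 1.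
Proof.
rewrite /inner /mxtrace !big_ord_recl !big_ord0 !mxE !big_ord_recl !big_ord0 !mxE.
rewrite [lift _ _](_ : _ = 1 :> 'I_2); last exact/val_inj.
by rewrite !addr0; ring.
Qed.

Lemma det_mx22 (R : realType) (A : 'M[R]_2) :
  \det A = A 0 0 * A 1 1 - A 0 1 * A 1 0.
Proof.
rewrite (expand_det_row _ 0) !big_ord_recl big_ord0 /cofactor !det_mx11 !mxE /=.
have e01 : lift ord0 ord0 = 1 :> 'I_2 by apply/val_inj.
have e10 : lift 1 0 = 0 :> 'I_2 by apply/val_inj.
by rewrite !e01 !e10 /= addn0 expr0 expr1; ring.
Qed.

Lemma frob_norm_sqr (R : realType) (A : 'M[R]_2) : frob_norm A ^+ 2 = inner A A.
Proof. by rewrite sqr_sqrtr // innerE -!expr2 !addr_ge0 // sqr_ge0. Qed.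

(** The infinitesimal actions of conjugation by rotations ([Zcomm]) and of the
rotations acting alike on both sides ([Zanti]); [X2] and [X3] are half their
pairings with the velocity. *)
Definition Zcomm (R : realType) (A : 'M[R]_2) : 'M[R]_2 :=
  Zmx R *m A - A *m Zmx R.

Definition Zanti (R : realType) (A : 'M[R]_2) : 'M[R]_2 :=
  Zmx R *m A + A *m Zmx R.

Lemma cof_is_linear (R : realType) : linear (@cof R).
Proof. by move=> a A B; rewrite /cof mulmxDr mulmxDl -scalemxAr -scalemxAl. Qed.

HB.instance Definition _ (R : realType) :=
  GRing.isLinear.Build R 'M[R]_2 'M[R]_2 *:%R (@cof R) (@cof_is_linear R).

Lemma Zcomm_is_linear (R : realType) : linear (@Zcomm R).
Proof.
move=> a A B; rewrite /Zcomm (mulmxDr (Zmx R)) (mulmxDl _ _ (Zmx R)) -!scalemxAr.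
by rewrite -!scalemxAl scalerBr opprD addrACA.
Qed.

HB.instance Definition _ (R : realType) :=
  GRing.isLinear.Build R 'M[R]_2 'M[R]_2 *:%R (@Zcomm R) (@Zcomm_is_linear R).

Lemma Zanti_is_linear (R : realType) : linear (@Zanti R).
Proof.
move=> a A B; rewrite /Zanti (mulmxDr (Zmx R)) (mulmxDl _ _ (Zmx R)) -!scalemxAr.
by rewrite -!scalemxAl scalerDr addrACA.
Qed.

HB.instance Definition _ (R : realType) :=
  GRing.isLinear.Build R 'M[R]_2 'M[R]_2 *:%R (@Zanti R) (@Zanti_is_linear R).

Lemma mulZmxE (R : realType) (A : 'M[R]_2) :
  [/\ (Zmx R *m A) 0 0 = - A 1 0, (Zmx R *m A) 0 1 = - A 1 1,
      (Zmx R *m A) 1 0 = A 0 0 & (Zmx R *m A) 1 1 = A 0 1].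
Proof.
rewrite !mxE !big_ord_recl !big_ord0 !mxE /=.
rewrite [lift _ _](_ : _ = 1 :> 'I_2); last exact/val_inj.
by split; ring.
Qed.

Lemma mulmxZE (R : realType) (A : 'M[R]_2) :
  [/\ (A *m Zmx R) 0 0 = A 0 1, (A *m Zmx R) 0 1 = - A 0 0,
      (A *m Zmx R) 1 0 = A 1 1 & (A *m Zmx R) 1 1 = - A 1 0].
Proof.
rewrite !mxE !big_ord_recl !big_ord0 !mxE /=.
rewrite [lift _ _](_ : _ = 1 :> 'I_2); last exact/val_inj.
by split; ring.
Qed.

Lemma cofE (R : realType) (A : 'M[R]_2) :
  [/\ cof A 0 0 = A 1 1, cof A 0 1 = - A 1 0,
      cof A 1 0 = - A 0 1 & cof A 1 1 = A 0 0].
Proof.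
have trZ : (Zmx R)^T = - Zmx R.
  by rewrite /Zmx raddfB /= !trmx_delta opprB.
have [z1 z2 z3 z4] := mulZmxE A.
have [y1 y2 y3 y4] := mulmxZE (Zmx R *m A).
have N i j : cof A i j = - (Zmx R *m A *m Zmx R) i j by rewrite /cof trZ mulmxN mxE.
by rewrite !N y1 y2 y3 y4 z1 z2 z3 z4 !opprK.
Qed.

Lemma ZcommE (R : realType) (A : 'M[R]_2) :
  [/\ Zcomm A 0 0 = - A 1 0 - A 0 1, Zcomm A 0 1 = A 0 0 - A 1 1,
      Zcomm A 1 0 = A 0 0 - A 1 1 & Zcomm A 1 1 = A 0 1 + A 1 0].
Proof.
have [z1 z2 z3 z4] := mulZmxE A; have [y1 y2 y3 y4] := mulmxZE A.
have N i j : Zcomm A i j = (Zmx R *m A) i j - (A *m Zmx R) i j by rewrite !mxE.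
by rewrite !N z1 z2 z3 z4 y1 y2 y3 y4; split; ring.
Qed.

Lemma ZantiE (R : realType) (A : 'M[R]_2) :
  [/\ Zanti A 0 0 = A 0 1 - A 1 0, Zanti A 0 1 = - A 1 1 - A 0 0,
      Zanti A 1 0 = A 0 0 + A 1 1 & Zanti A 1 1 = A 0 1 - A 1 0].
Proof.
have [z1 z2 z3 z4] := mulZmxE A; have [y1 y2 y3 y4] := mulmxZE A.
have N i j : Zanti A i j = (Zmx R *m A) i j + (A *m Zmx R) i j by rewrite !mxE.
by rewrite !N z1 z2 z3 z4 y1 y2 y3 y4; split; ring.
Qed.

Lemma innerC (R : realType) (A B : 'M[R]_2) : inner A B = inner B A.
Proof. by rewrite !innerE; ring. Qed.

Lemma innerZr (R : realType) (a : R) (A B : 'M[R]_2) :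
  inner A (a *: B) = a * inner A B.
Proof. by rewrite !innerE !mxE; ring. Qed.

Lemma inner_cofC (R : realType) (A B : 'M[R]_2) :
  inner (cof A) B = inner A (cof B).
Proof.
by rewrite !innerE; case: (cofE A) => -> -> -> ->; case: (cofE B) => -> -> -> ->; ring.
Qed.

Lemma inner_cof_cof (R : realType) (A : 'M[R]_2) :
  inner (cof A) (cof A) = inner A A.
Proof. by rewrite !innerE; case: (cofE A) => -> -> -> ->; ring. Qed.

Lemma inner_cof (R : realType) (A : 'M[R]_2) : inner A (cof A) = 2 * \det A.
Proof. by rewrite !innerE det_mx22; case: (cofE A) => -> -> -> ->; ring. Qed.

Lemma inner_Zcomm (R : realType) (B : 'M[R]_2) : inner (Zcomm B) B = 0.
Proof. by rewrite !innerE; case: (ZcommE B) => -> -> -> ->; ring. Qed.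

Lemma inner_Zanti (R : realType) (B : 'M[R]_2) : inner (Zanti B) B = 0.
Proof. by rewrite !innerE; case: (ZantiE B) => -> -> -> ->; ring. Qed.

Lemma inner_Zcomm_cof (R : realType) (B : 'M[R]_2) : inner (Zcomm B) (cof B) = 0.
Proof.
by rewrite !innerE; case: (ZcommE B) => -> -> -> ->; case: (cofE B) => -> -> -> ->; ring.
Qed.

Lemma inner_Zanti_cof (R : realType) (B : 'M[R]_2) : inner (Zanti B) (cof B) = 0.
Proof.
by rewrite !innerE; case: (ZantiE B) => -> -> -> ->; case: (cofE B) => -> -> -> ->; ring.
Qed.

(** A polynomial identity valid for all [A] and [B]. It is used twice: along the
motion, where [\det A = 1] and [<B, cof A> = 0], and for the asymptotic pair,
where [\det B = 0] and [<B, cof A> = 0]. *)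
Lemma frob_norm_sqr_det (R : realType) (A B : 'M[R]_2) :
  frob_norm A ^+ 2 * \det B =
  X3 A B ^+ 2 - X2 A B ^+ 2 - 2 * \det A * X1 A B
  + inner B (cof A) * inner A B.
Proof.
rewrite /X1 /X2 /X3 !frob_norm_sqr -/(Zcomm A) -/(Zanti A) !innerE !det_mx22.
case: (ZcommE A) => -> -> -> ->; case: (ZantiE A) => -> -> -> ->.
by case: (cofE A) => -> -> -> ->; field.
Qed.

Lemma frob_norm_ge0 (R : realType) (A : 'M[R]_2) : 0 <= frob_norm A.
Proof. exact: sqrtr_ge0. Qed.

Lemma frob_norm_eq0 (R : realType) (A : 'M[R]_2) : frob_norm A = 0 -> A = 0.
Proof.
move=> /(congr1 (fun x => x ^+ 2)); rewrite expr0n /= frob_norm_sqr innerE => h.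
have e00 : A 0 0 = 0 by nra.
have e01 : A 0 1 = 0 by nra.
have e10 : A 1 0 = 0 by nra.
have e11 : A 1 1 = 0 by nra.
by apply: mx22P; rewrite mxE.
Qed.

(** * One-variable calculus on a half-line *)

Lemma derive_ge0_le (R : realType) (f df : R -> R) (T : R) :
  (forall t : R, T <= t -> is_derive t 1 f (df t)) ->
  (forall t, T <= t -> 0 <= df t) ->
  forall s t, T <= s -> s <= t -> f s <= f t.
Proof.
move=> fdf df0 s t Ts st.
have [x xs||c] := @MVT_segment R f df s t st.
- by apply: fdf; rewrite (le_trans Ts) // (itvP xs).
- apply: derivable_within_continuous => x xs.
  by have [] := fdf x _; rewrite // (le_trans Ts) // (itvP xs).
- move=> cst e; rewrite -subr_ge0 e mulr_ge0 ?subr_ge0 // df0 //.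
  by rewrite (le_trans Ts) // (itvP cst).
Qed.

(** If the speed of [g] is at most the rate of decrease of a nonnegative [h],
then [g - h] increases, [g + h] decreases, and the number separating their
ranges is within [h t] of [g t]. *)
Lemma dominated_derive_limit (R : realType) (g dg h dh : R -> R) :
  (forall t : R, 0 <= t -> is_derive t 1 g (dg t)) ->
  (forall t : R, 0 <= t -> is_derive t 1 h (- dh t)) ->
  (forall t, 0 <= t -> `|dg t| <= dh t) ->
  (forall t, 0 <= t -> 0 <= h t) ->
  exists l, forall t, 0 <= t -> `|g t - l| <= h t.
Proof.
move=> gdg hdh dgdh h0.
have up s t : 0 <= s -> s <= t -> (g - h) s <= (g - h) t.
  apply: (@derive_ge0_le R (g - h) (fun t => dg t + dh t)) => x x0.
    have := gdg x x0; have := hdh x x0 => ? ?.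
    by apply: is_derive_eq; rewrite opprK.
  by have := dgdh x x0; rewrite ler_norml; lra.
have dn s t : 0 <= s -> s <= t -> (- g - h) s <= (- g - h) t.
  apply: (@derive_ge0_le R (- g - h) (fun t => - dg t + dh t)) => x x0.
    have := gdg x x0; have := hdh x x0 => ? ?.
    by apply: is_derive_eq; rewrite opprK.
  by have := dgdh x x0; rewrite ler_norml; lra.
have cross s t : 0 <= s -> 0 <= t -> (g - h) s <= (g + h) t.
  move=> s0 t0; apply: (@le_trans _ _ ((g - h) (Num.max s t))).
    by apply: up; rewrite // le_max lexx.
  apply: (@le_trans _ _ ((g + h) (Num.max s t))).
    have m0 : 0 <= Num.max s t by rewrite le_max s0.
    by have := h0 _ m0; rewrite /= => ?; rewrite !fctE; lra.
  have : (- g - h) t <= (- g - h) (Num.max s t).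
    by apply: dn; rewrite // le_max lexx orbT.
  by rewrite !fctE; lra.
pose E := [set x | exists2 s, 0 <= s & x = (g - h) s].
have E0 : E !=set0 by exists ((g - h) 0); exists 0.
exists (sup E) => t t0.
have lb : (g - h) t <= sup E.
  apply: ub_le_sup; last by exists t.
  by exists ((g + h) 0) => _ [s s0 ->]; apply: cross.
have ub : sup E <= (g + h) t by apply: ge_sup => // _ [s s0 ->]; apply: cross.
by move: lb ub; rewrite !fctE ler_norml => *; lra.
Qed.

Lemma is_derive_inv_exp (R : realType) (n : nat) (t : R) : 0 <= t ->
  is_derive t 1 (fun s : R => (1 + s) ^- n.+1) (- (n.+1%:R * (1 + t) ^- n.+2)).
Proof.
move=> t0; have p0 : 1 + t != 0 by rewrite gt_eqF // ltr_pwDl.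
pose f : R -> R := (cst 1 + id) ^+ n.+1.
have -> : (fun s : R => (1 + s) ^- n.+1) = (fun s => (f s)^-1).
  by apply/funext => s; rewrite /f fctE.
have f0 : f t != 0 by rewrite /f fctE expf_neq0.
have fd : is_derive t 1 f (n.+1%:R * (1 + t) ^+ n).
  by apply: is_derive_eq; rewrite /= add0r /GRing.scale /= mulr1.
apply: (is_derive_eq (is_deriveV f0 fd)).
rewrite /f !fctE /GRing.scale /= !exprS.
by field; rewrite p0 expf_neq0.
Qed.

(** Two integrations of an acceleration of size [(1 + t) ^- 3]. *)
Lemma affine_asymptotics (R : realType) (f df ddf : R -> R) (C : R) :
  (forall t : R, 0 <= t -> is_derive t 1 f (df t)) ->
  (forall t : R, 0 <= t -> is_derive t 1 df (ddf t)) ->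
  (forall t, 0 <= t -> `|ddf t| <= C * (1 + t) ^- 3) ->
  exists a b, forall t, 0 <= t ->
    `|f t - (t * b + a)| <= C * (1 + t) ^- 1 /\ `|df t - b| <= C * (1 + t) ^- 2.
Proof.
move=> fdf dfddf bnd.
have C0 : 0 <= C.
  by have := le_trans (normr_ge0 _) (bnd 0 (lexx _)); rewrite addr0 expr1n invr1 mulr1.
have inv0 n (t : R) : 0 <= t -> 0 <= (1 + t) ^- n.
  by move=> t0; rewrite invr_ge0 exprn_ge0 // addr_ge0.
have [b hb] : exists b, forall t, 0 <= t -> `|df t - b| <= C / 2 * (1 + t) ^- 2.
  apply: (@dominated_derive_limit R df ddf (fun t => C / 2 * (1 + t) ^- 2)
    (fun t => C * (1 + t) ^- 3)) => [|//|] t t0.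
    have := is_derive_inv_exp 1 t0 => H.
    have := is_deriveZ (C / 2) H => /is_derive_eq; apply.
    by rewrite /GRing.scale /=; field; rewrite gt_eqF // ltr_pwDl.
  by rewrite mulr_ge0 ?inv0 // divr_ge0.
have [a ha] : exists a, forall t, 0 <= t ->
    `|(f - ( *%R^~ b)) t - a| <= C / 2 * (1 + t) ^- 1.
  apply: (@dominated_derive_limit R (f - *%R^~ b) (fun t => df t - b)
    (fun t => C / 2 * (1 + t) ^- 1) (fun t => C / 2 * (1 + t) ^- 2)) => [||//|] t t0.
  - have := fdf t t0 => ?.
    have H : is_derive t 1 ( *%R^~ b) b.
      have -> : ( *%R^~ b) = b *: (id : R -> R).
        by apply/funext => s; rewrite mulrC.
      by apply: is_derive_eq; rewrite /GRing.scale /= mulr1.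
    by apply: is_derive_eq.
  - have := is_derive_inv_exp 0 t0 => H.
    have := is_deriveZ (C / 2) H => /is_derive_eq; apply.
    by rewrite /GRing.scale /=; field; rewrite gt_eqF // ltr_pwDl.
  - by rewrite mulr_ge0 ?inv0 // divr_ge0.
have half (x : R) : 0 <= x -> C / 2 * x <= C * x.
  by move=> x0; rewrite ler_wpM2r //; lra.
exists a, b => t t0; split; last by rewrite (le_trans (hb t t0)) // half ?inv0.
rewrite opprD addrA; apply: (le_trans (ha t t0)).
by rewrite half // inv0.
Qed.

Lemma is_derive_sub_quadratic (R : realType) (f : R -> R) (df c e t : R) :
  is_derive t 1 f df ->
  is_derive t 1 (fun s => f s - (c * s + e / 2 * s ^+ 2)) (df - (c + e * t)).
Proof.
move=> H.
have -> : (fun s => f s - (c * s + e / 2 * s ^+ 2)) =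
    f - (c *: (id : R -> R) + (e / 2) *: ((id : R -> R) ^+ 2)).
  by apply/funext => s; rewrite !fctE.
have dl := is_deriveZ c (is_derive_id t (1 : R)).
have dq := is_deriveZ (e / 2) (is_deriveX 2 (is_derive_id t (1 : R))).
apply: (is_derive_eq (is_deriveB H (is_deriveD dl dq))).
by rewrite /GRing.scale /=; field.
Qed.

(** A function bounded below by [1] whose second derivative is eventually at
least [e > 0] dominates a multiple of [(1 + t) ^+ 2] on the whole half-line. *)
Lemma quadratic_growth (R : realType) (y dy ddy : R -> R) (e T : R) :
  0 < e ->
  (forall t : R, is_derive t 1 y (dy t)) ->
  (forall t : R, is_derive t 1 dy (ddy t)) ->
  (forall t, T <= t -> e <= ddy t) ->
  (forall t, 1 <= y t) ->
  exists2 d, 0 < d & forall t, 0 <= t -> d * (1 + t) ^+ 2 <= y t.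
Proof.
move=> e0 ydy dyddy ge_e y1.
pose c := dy T - e * T.
have dy_ge t : T <= t -> c + e * t <= dy t.
  move=> Tt.
  have := @derive_ge0_le R _ _ T (fun s _ => is_derive_sub_quadratic e 0 (dyddy s)).
  move=> /(_ _ T t (lexx _) Tt); rewrite /c.
  move=> H; suff: dy T - (e * T + 0 / 2 * T ^+ 2) <= dy t - (e * t + 0 / 2 * t ^+ 2) by lra.
  by apply: H => s Ts; rewrite mul0r addr0 subr_ge0; apply: ge_e.
have y_ge t : T <= t -> 1 + c * (t - T) + e / 2 * (t ^+ 2 - T ^+ 2) <= y t.
  move=> Tt.
  have := @derive_ge0_le R _ _ T (fun s _ => is_derive_sub_quadratic c e (ydy s)).
  move=> /(_ _ T t (lexx _) Tt) H.
  suff: y T - (c * T + e / 2 * T ^+ 2) <= y t - (c * t + e / 2 * t ^+ 2).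
    by have := y1 T; lra.
  by apply: H => s Ts; rewrite subr_ge0; apply: dy_ge.
(* with [x = t - T], the lower bound for [y] is [1 + dy T * x + e / 2 * x ^+ 2],
   which exceeds [e / 4 * x ^+ 2 >= e / 16 * (1 + t) ^+ 2] from [S] on *)
pose S := T + 4 * `|dy T| / e + 1 + `|T|.
have q0 : 0 <= 4 * `|dy T| / e by rewrite divr_ge0 ?mulr_ge0 // ltW.
have S0 : 0 <= S by have := ler_norm (- T); rewrite normrN /S; lra.
have far t : S <= t -> e / 16 * (1 + t) ^+ 2 <= y t.
  move=> St; pose x := t - T.
  have nT := ler_norm T; have nT0 := normr_ge0 T.
  have Tt : T <= t by move: St; rewrite /S; lra.
  have x1 : 1 + `|T| <= x by move: St; rewrite /S /x; lra.
  have xe : 4 * `|dy T| <= e * x.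
    by rewrite [e * x]mulrC -ler_pdivrMr //; move: St; rewrite /S /x; lra.
  have nd : - dy T <= `|dy T| by rewrite -normrN ler_norm.
  have x0 : 0 <= x by lra.
  have drift : 0 <= (e / 4 * x + dy T) * x by rewrite mulr_ge0 //; lra.
  have sq : (1 + t) ^+ 2 <= 4 * x ^+ 2.
    have -> : 4 * x ^+ 2 = (2 * x) ^+ 2 by ring.
    rewrite lerXn2r // ?nnegrE; last by rewrite /x in x1 *; lra.
    + by move: St; lra.
    + by lra.
  have esq : e / 16 * (1 + t) ^+ 2 <= e / 16 * (4 * x ^+ 2).
    by rewrite ler_pM2l // divr_gt0.
  have := y_ge t Tt; move: drift esq; rewrite /c /x; lra.
(* before [S] the bound [1 <= y] suffices *)
pose d := Num.min (e / 16) ((1 + S) ^- 2).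
have pS : 0 < (1 + S) ^+ 2 by rewrite exprn_gt0 // ltr_pwDl.
exists d; first by rewrite lt_min divr_gt0 //= invr_gt0.
move=> t t0; have pt : 0 <= (1 + t) ^+ 2 by rewrite sqr_ge0.
have [St|tS] := lerP S t.
  apply: le_trans (far t St); rewrite ler_wpM2r // ge_min lexx //.
apply: le_trans (y1 t); apply: (@le_trans _ _ ((1 + S) ^- 2 * (1 + t) ^+ 2)).
  by rewrite ler_wpM2r // ge_min lexx orbT.
rewrite mulrC ler_pdivrMr // mul1r lerXn2r // ?nnegrE; lra.
Qed.

(** * Entrywise calculus of matrix-valued functions *)

(** Differentiability and convergence of a matrix-valued function are recorded
entry by entry. *)
Definition mx_is_derive (R : realType) (F : R -> 'M[R]_2) (t : R) (D : 'M[R]_2) :=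
  forall i j, is_derive t 1 (fun s => F s i j) (D i j).

Definition mx_cvgy (R : realType) (F : R -> 'M[R]_2) (L : 'M[R]_2) :=
  forall i j, F t i j @[t --> +oo] --> L i j.

Lemma mx_is_derive_derive1 (R : realType) (F : R -> 'M[R]_2) (t : R) :
  derivable F t 1 -> mx_is_derive F t (F^`()%classic t).
Proof.
move=> dF i j; have /derivableP H := (derivable_mxP F t 1).1 dF i j.
by apply: (is_derive_eq H); rewrite derive1E derive_mx // mxE.
Qed.

Lemma linear_entryE (R : realType) (l : {linear 'M[R]_2 -> 'M[R]_2})
    (M : 'M[R]_2) i j :
  l M i j = M 0 0 * l (delta_mx 0 0) i j + M 0 1 * l (delta_mx 0 1) i j
            + M 1 0 * l (delta_mx 1 0) i j + M 1 1 * l (delta_mx 1 1) i j.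
Proof.
have {1}-> : M = M 0 0 *: delta_mx 0 0 + M 0 1 *: delta_mx 0 1
    + M 1 0 *: delta_mx 1 0 + M 1 1 *: delta_mx 1 1.
  by apply: mx22P; rewrite !mxE /= !(mulr1, mulr0, addr0, add0r).
by rewrite !linearD !linearZ !mxE.
Qed.

Lemma mx_is_derive_linear (R : realType) (l : {linear 'M[R]_2 -> 'M[R]_2})
    (F : R -> 'M[R]_2) (t : R) (D : 'M[R]_2) :
  mx_is_derive F t D -> mx_is_derive (fun s => l (F s)) t (l D).
Proof.
move=> dF i j.
have -> : (fun s => l (F s) i j) =
    l (delta_mx 0 0) i j *: (fun s => F s 0 0)
    + l (delta_mx 0 1) i j *: (fun s => F s 0 1)
    + l (delta_mx 1 0) i j *: (fun s => F s 1 0)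
    + l (delta_mx 1 1) i j *: (fun s => F s 1 1).
  apply/funext => s; rewrite linear_entryE !fctE /GRing.scale /=; ring.
have d c k m := is_deriveZ c (dF k m).
apply: (is_derive_eq (is_deriveD (is_deriveD (is_deriveD (d _ 0 0) (d _ 0 1))
  (d _ 1 0)) (d _ 1 1))).
by rewrite [RHS]linear_entryE /GRing.scale /=; ring.
Qed.

Lemma is_derive_inner (R : realType) (F G : R -> 'M[R]_2) (t : R) (D E : 'M[R]_2) :
  mx_is_derive F t D -> mx_is_derive G t E ->
  is_derive t 1 (fun s => inner (F s) (G s)) (inner D (G t) + inner (F t) E).
Proof.
move=> dF dG.
have -> : (fun s => inner (F s) (G s)) =
    (fun s => F s 0 0) * (fun s => G s 0 0) + (fun s => F s 0 1) * (fun s => G s 0 1)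
    + (fun s => F s 1 0) * (fun s => G s 1 0)
    + (fun s => F s 1 1) * (fun s => G s 1 1).
  by apply/funext => s; rewrite innerE !fctE.
have d i j := is_deriveM (dF i j) (dG i j).
apply: (is_derive_eq (is_deriveD (is_deriveD (is_deriveD (d 0 0) (d 0 1))
  (d 1 0)) (d 1 1))).
by rewrite !innerE /GRing.scale /=; ring.
Qed.

Lemma is_derive_cst_eq0 (R : realType) (f : R -> R) (c t d : R) :
  (forall s, f s = c) -> is_derive t 1 f d -> d = 0.
Proof.
move=> fc [_ <-]; have -> : f = cst c by apply/funext.
by rewrite derive_cst.
Qed.

Lemma cvg_inner (R : realType) (F G : R -> 'M[R]_2) (L M : 'M[R]_2) :
  mx_cvgy F L -> mx_cvgy G M ->
  inner (F t) (G t) @[t --> +oo] --> inner L M.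
Proof.
move=> cF cG; rewrite innerE; under eq_fun do rewrite innerE.
by do 3?apply: cvgD; apply: cvgM.
Qed.

Lemma mx_cvgy_linear (R : realType) (l : {linear 'M[R]_2 -> 'M[R]_2})
    (F : R -> 'M[R]_2) (L : 'M[R]_2) :
  mx_cvgy F L -> mx_cvgy (fun t => l (F t)) (l L).
Proof.
move=> cF i j; rewrite linear_entryE; under eq_fun do rewrite linear_entryE.
by do 3?apply: cvgD; apply: cvgMr_tmp.
Qed.

(** If [F] is asymptotic to [t *: L1 + L0] and [G] to [L1], a bilinear form
that vanishes at [(L1, L1)] does not see the growth of [F]. *)
Lemma cvg_bilinear_affine (R : realType) (l : {linear 'M[R]_2 -> 'M[R]_2})
    (F G : R -> 'M[R]_2) (L0 L1 : 'M[R]_2) :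
  inner (l L1) L1 = 0 ->
  mx_cvgy (fun t => F t - t *: L1) L0 -> mx_cvgy G L1 ->
  mx_cvgy (fun t => t *: (G t - L1)) 0 ->
  inner (l (F t)) (G t) @[t --> +oo] --> inner (l L0) L1.
Proof.
move=> l0 cF cG ctG.
have -> : (fun t => inner (l (F t)) (G t)) =
    (fun t => inner (l (F t - t *: L1)) (G t) + inner (l L1) (t *: (G t - L1))).
  apply/funext => t; rewrite linearB linearZ /=.
  have : t * inner (l L1) L1 = 0 by rewrite l0 mulr0.
  by rewrite !innerE !mxE; lra.
rewrite -[X in _ --> X]addr0; apply: cvgD.
  exact: cvg_inner (mx_cvgy_linear cF) cG.
have -> : 0 = inner (l L1) 0 by rewrite innerE !mxE; ring.
by apply: cvg_inner => // i j; apply: cvg_cst.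
Qed.

(** * Conservation laws of the flow *)

Lemma solution_is_derive1 (R : realType) (A : R -> 'M[R]_2) (t : R) :
  is_solution A -> mx_is_derive A t (A^`()%classic t).
Proof. by move=> [_ [dA _] _]; apply: mx_is_derive_derive1; apply: (dA 0). Qed.

Lemma solution_is_derive2 (R : realType) (A : R -> 'M[R]_2) (t : R) :
  is_solution A -> mx_is_derive A^`()%classic t (A^`(2)%classic t).
Proof.
move=> [_ [dA _] _]; rewrite derive1nS derive1n1.
by apply: mx_is_derive_derive1; have := dA 1 isT t; rewrite derive1n1.
Qed.

(** The velocity stays tangent to the level set [\det = 1]. *)
Lemma solution_tangent (R : realType) (A : R -> 'M[R]_2) (t : R) :
  is_solution A -> inner (A^`()%classic t) (cof (A t)) = 0.
Proof.
move=> sA; have [det1 _ _] := sA; have dA := solution_is_derive1 t sA.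
have /(is_derive_cst_eq0 (c := 2)) := is_derive_inner dA (mx_is_derive_linear (@cof R) dA).
have N s : inner (A s) (cof (A s)) = 2 by rewrite inner_cof det1 mulr1.
by move=> /(_ N); rewrite -inner_cofC [inner (cof _) _]innerC; lra.
Qed.

(** A pairing [<l A, A'>] is conserved once [l] is skew and [l A] is orthogonal
to the direction [cof A] of the acceleration. *)
Lemma solution_inner_cst (R : realType) (A : R -> 'M[R]_2)
    (l : {linear 'M[R]_2 -> 'M[R]_2}) (t : R) :
  is_solution A ->
  (forall B, inner (l B) B = 0) -> (forall B, inner (l B) (cof B) = 0) ->
  inner (l (A t)) (A^`()%classic t) = inner (l (A 0)) (A^`()%classic 0).
Proof.
move=> sA l0 lcof; have [_ _ [lam [_ ode]]] := sA.
apply: (@is_derive_0_is_cst R (fun s => inner (l (A s)) (A^`()%classic s))) => s.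
have dA := solution_is_derive1 s sA; have ddA := solution_is_derive2 s sA.
apply: (is_derive_eq (is_derive_inner (mx_is_derive_linear l dA) ddA)).
by rewrite l0 ode innerZr lcof; ring.
Qed.

Lemma solution_X2 (R : realType) (A : R -> 'M[R]_2) (t : R) :
  is_solution A -> X2 (A t) (A^`()%classic t) = X2 (A 0) (A^`()%classic 0).
Proof.
move=> sA; rewrite /X2 -/(Zcomm (A t)) -/(Zcomm (A 0)).
by rewrite (solution_inner_cst t sA (@inner_Zcomm R) (@inner_Zcomm_cof R)).
Qed.

Lemma solution_X3 (R : realType) (A : R -> 'M[R]_2) (t : R) :
  is_solution A -> X3 (A t) (A^`()%classic t) = X3 (A 0) (A^`()%classic 0).
Proof.
move=> sA; rewrite /X3 -/(Zanti (A t)) -/(Zanti (A 0)).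
by rewrite (solution_inner_cst t sA (@inner_Zanti R) (@inner_Zanti_cof R)).
Qed.

Lemma solution_X1 (R : realType) (A : R -> 'M[R]_2) (t : R) :
  is_solution A -> X1 (A t) (A^`()%classic t) = X1 (A 0) (A^`()%classic 0).
Proof.
move=> sA; have [_ _ [lam [_ ode]]] := sA.
rewrite /X1 !frob_norm_sqr; congr (_ * _).
apply: (@is_derive_0_is_cst R (fun s => inner (A^`()%classic s) (A^`()%classic s))) => s.
have ddA := solution_is_derive2 s sA.
apply: (is_derive_eq (is_derive_inner ddA ddA)).
by rewrite [X in X + _]innerC ode innerZr solution_tangent //; ring.
Qed.

(** The conserved quantity [|A| ^+ 2 * \det A']. It governs the multiplier:
[lam * |A| ^+ 4] is [-2] times this constant. *)
Definition multiplier_constant (R : realType) (A0 B0 : 'M[R]_2) : R :=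
  X3 A0 B0 ^+ 2 - X2 A0 B0 ^+ 2 - 2 * X1 A0 B0.

Lemma solution_det_derive (R : realType) (A : R -> 'M[R]_2) (t : R) :
  is_solution A ->
  frob_norm (A t) ^+ 2 * \det (A^`()%classic t) =
  multiplier_constant (A 0) (A^`()%classic 0).
Proof.
move=> sA; have [det1 _ _] := sA.
rewrite frob_norm_sqr_det solution_tangent // det1.
by rewrite solution_X1 // solution_X2 // solution_X3 // /multiplier_constant; ring.
Qed.

Lemma solution_multiplier (R : realType) (A : R -> 'M[R]_2) (lam : R -> R) (t : R) :
  is_solution A -> (forall t, A^`(2)%classic t = lam t *: cof (A t)) ->
  lam t * (frob_norm (A t) ^+ 2) ^+ 2 =
  - (2 * multiplier_constant (A 0) (A^`()%classic 0)).
Proof.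
move=> sA ode; rewrite -(solution_det_derive t sA).
have dA := solution_is_derive1 t sA; have ddA := solution_is_derive2 t sA.
(* differentiate [<A', cof A> = 0] *)
have /is_derive_cst_eq0 := is_derive_inner ddA (mx_is_derive_linear (@cof R) dA).
move=> /(_ _ (fun s => solution_tangent s sA)).
rewrite ode innerC innerZr inner_cof_cof inner_cof -frob_norm_sqr => /eqP.
by rewrite addrC addr_eq0 => /eqP; rewrite [2 * (_ * _)]mulrCA => ->; ring.
Qed.

Lemma solution_frob_norm_ge1 (R : realType) (A : R -> 'M[R]_2) (t : R) :
  is_solution A -> 1 <= frob_norm (A t) ^+ 2.
Proof.
move=> [det1 _ _]; have := det1 t; rewrite /SL2 /= det_mx22 frob_norm_sqr innerE => H.
have := sqr_ge0 (A t 0 0 - A t 1 1); have := sqr_ge0 (A t 0 1 + A t 1 0).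
by rewrite !expr2; lra.
Qed.

(** * Quadratic growth and decay of the acceleration *)

(** A solution of zero energy is at rest, hence bounded. *)
Lemma solution_energy_gt0 (R : realType) (A : R -> 'M[R]_2) :
  is_solution A -> frob_norm (A t) ^+ 2 @[t --> +oo] --> +oo ->
  0 < X1 (A 0) (A^`()%classic 0).
Proof.
move=> sA Ay; rewrite lt_neqAle {2}/X1 mulr_ge0 ?sqr_ge0 ?invr_ge0 // andbT.
apply/eqP => X10.
have A'0 t : A^`()%classic t = 0.
  apply: frob_norm_eq0; apply/eqP; rewrite -sqrf_eq0.
  by have := solution_X1 t sA; rewrite -X10 /X1 => ?; apply/eqP; lra.
have cst t : frob_norm (A t) ^+ 2 = frob_norm (A 0) ^+ 2.
  rewrite !frob_norm_sqr.
  apply: (@is_derive_0_is_cst R (fun s => inner (A s) (A s))) => s.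
  have dA := solution_is_derive1 s sA.
  by apply: (is_derive_eq (is_derive_inner dA dA)); rewrite A'0 !innerE !mxE; ring.
move/cvgryPge : Ay => /(_ (frob_norm (A 0) ^+ 2 + 1)) [M [_ H]].
by have := H (M + 1); rewrite cst ltrDl ltr01 => /(_ isT); lra.
Qed.

Lemma solution_quadratic_growth (R : realType) (A : R -> 'M[R]_2) :
  is_solution A -> frob_norm (A t) ^+ 2 @[t --> +oo] --> +oo ->
  exists2 d, 0 < d &
    forall t, 0 <= t -> d * (1 + t) ^+ 2 <= frob_norm (A t) ^+ 2.
Proof.
move=> sA Ay; have [det1 _ [lam [_ ode]]] := sA.
set E := X1 (A 0) (A^`()%classic 0); set k := multiplier_constant (A 0) (A^`()%classic 0).
have E0 : 0 < E := solution_energy_gt0 sA Ay.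
move/cvgryPge : Ay => /(_ (Num.max 1 (4 * `|k| / E))) [M [_ H]].
have dN (t : R) : is_derive t 1 (fun s => frob_norm (A s) ^+ 2)
    (2 * inner (A t) (A^`()%classic t)).
  have -> : (fun s => frob_norm (A s) ^+ 2) = (fun s => inner (A s) (A s)).
    by apply/funext => s; rewrite frob_norm_sqr.
  have dA := solution_is_derive1 t sA.
  by apply: (is_derive_eq (is_derive_inner dA dA)); rewrite innerC; ring.
have ddN (t : R) : is_derive t 1 (fun s => 2 * inner (A s) (A^`()%classic s))
    (4 * E + 4 * lam t).
  have dA := solution_is_derive1 t sA; have ddA := solution_is_derive2 t sA.
  apply: (is_derive_eq (is_deriveZ 2 (is_derive_inner dA ddA))).
  rewrite /E -(solution_X1 t sA) /X1 frob_norm_sqr ode innerZr inner_cof det1.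
  by rewrite /GRing.scale /=; field.
apply: (@quadratic_growth R _ _ _ (2 * E) (M + 1) _ dN ddN) => [|t Mt|t].
- by rewrite mulr_gt0.
- have /H : M < t by lra.
  set N := _ ^+ 2; rewrite ge_max => /andP[N1].
  rewrite ler_pdivrMr // => kN.
  have lamN : lam t * N ^+ 2 = - (2 * k) := solution_multiplier t sA ode.
  (* [4 * |k| / E <= N <= N ^+ 2] makes the multiplier at most [E / 2] in size *)
  suff : - (E / 2) <= lam t by lra.
  rewrite -(ler_pM2r (_ : 0 < N ^+ 2)); last by rewrite exprn_gt0 // (lt_le_trans ltr01).
  rewrite lamN; have := ler_norm k.
  have : N * E <= N ^+ 2 * E by rewrite ler_pM2r // expr2 ler_peMl // (le_trans ler01).
  lra.
- exact: solution_frob_norm_ge1.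
Qed.

Lemma entry_sqr_le_frob_norm (R : realType) (M : 'M[R]_2) i j :
  M i j ^+ 2 <= frob_norm M ^+ 2.
Proof.
rewrite frob_norm_sqr innerE -!expr2.
have := sqr_ge0 (M 0 0); have := sqr_ge0 (M 0 1).
have := sqr_ge0 (M 1 0); have := sqr_ge0 (M 1 1).
by case: (ord2P i) => ->; case: (ord2P j) => ->; lra.
Qed.

Lemma frob_norm_le_entries (R : realType) (M : 'M[R]_2) (c : R) :
  0 <= c -> (forall i j, `|M i j| <= c) -> frob_norm M <= 2 * c.
Proof.
move=> c0 Mc.
have sq i j : M i j ^+ 2 <= c ^+ 2 by rewrite -real_normK ?num_real // lerXn2r ?nnegrE.
rewrite -ler_sqr ?nnegrE ?frob_norm_ge0 ?mulr_ge0 //.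
rewrite frob_norm_sqr innerE -!expr2 exprMn.
have := sq 0 0; have := sq 0 1; have := sq 1 0; have := sq 1 1; lra.
Qed.

(** [|A''| ^+ 2 * |A| ^+ 6] is conserved. *)
Lemma solution_acceleration (R : realType) (A : R -> 'M[R]_2) (t : R) :
  is_solution A ->
  frob_norm (A^`(2)%classic t) ^+ 2 * (frob_norm (A t) ^+ 2) ^+ 3 =
  (2 * multiplier_constant (A 0) (A^`()%classic 0)) ^+ 2.
Proof.
move=> sA; have [_ _ [lam [_ ode]]] := sA.
rewrite -[RHS]sqrrN -(solution_multiplier t sA ode).
rewrite [X in X * _]frob_norm_sqr ode innerZr innerC innerZr inner_cof_cof.
by rewrite -frob_norm_sqr; ring.
Qed.

Lemma solution_acceleration_decay (R : realType) (A : R -> 'M[R]_2) :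
  is_solution A -> frob_norm (A t) ^+ 2 @[t --> +oo] --> +oo ->
  exists C, forall t, 0 <= t ->
    forall i j, `|A^`(2)%classic t i j| <= C * (1 + t) ^- 3.
Proof.
move=> sA Ay; have [d d0 grow] := solution_quadratic_growth sA Ay.
set k := multiplier_constant (A 0) (A^`()%classic 0).
exists (2 * `|k| / Num.sqrt d ^+ 3) => t t0 i j.
have s0 : 0 < Num.sqrt d by rewrite sqrtr_gt0.
have p0 : 0 < 1 + t by rewrite ltr_pwDl.
rewrite -[leRHS]mulrA -invfM -exprMn.
rewrite ler_pdivlMr ?exprn_gt0 ?mulr_gt0 //.
rewrite -ler_sqr ?nnegrE ?mulr_ge0 ?exprn_ge0 ?mulr_ge0 ?(ltW s0) ?(ltW p0) //.
rewrite [in leRHS]exprMn real_normK ?num_real // -exprMn -(solution_acceleration t sA).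
rewrite [(`|_| * _) ^+ 2]exprMn real_normK ?num_real //.
have -> : ((Num.sqrt d * (1 + t)) ^+ 3) ^+ 2 = (d * (1 + t) ^+ 2) ^+ 3.
  by rewrite -[in RHS](sqr_sqrtr (ltW d0)); ring.
have q0 : 0 <= d * (1 + t) ^+ 2 by rewrite mulr_ge0 ?sqr_ge0 // ltW.
apply: ler_pM; rewrite ?sqr_ge0 ?entry_sqr_le_frob_norm ?exprn_ge0 //.
by rewrite lerXn2r ?nnegrE ?sqr_ge0 // grow.
Qed.

(** * The asymptotic line *)

Lemma cvgy_cst_eq (R : realType) (f : R -> R) (c l : R) :
  (forall t, f t = c) -> f t @[t --> +oo] --> l -> l = c.
Proof.
move=> fc; have -> : f = cst c by apply/funext.
by move=> /cvg_lim <- //; rewrite lim_cst.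
Qed.

Lemma cvgy_le_inv (R : realType) (f : R -> R) (C : R) :
  (forall t, 0 <= t -> `|f t| <= C * (1 + t) ^- 1) -> f t @[t --> +oo] --> 0.
Proof.
move=> fC; apply/cvgrPdist_le => e e0.
exists (Num.max 0 (C / e)); split; first exact: num_real.
move=> t; rewrite gt_max => /andP[t0 Ct].
rewrite sub0r normrN; apply: le_trans (fC t (ltW t0)) _.
have p0 : 0 < 1 + t by lra.
rewrite expr1 ler_pdivrMr //; move: Ct; rewrite ltr_pdivrMr // => Ct.
by rewrite mulrDr mulr1 [e * t]mulrC; lra.
Qed.

Lemma affine_cvgy0 (R : realType) (p q : R) :
  t * p + q @[t --> +oo] --> 0 -> p = 0 /\ q = 0.
Proof.
move=> /cvgrPdist_lt H.
(* [p] is the difference of two small values of [t * p + q], at [M + 1] and [M + 2] *)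
have p0 : p = 0.
  apply/eqP; apply: contraT; rewrite -normr_gt0 => p0.
  have [M [_ HM]] := H (`|p| / 2) (divr_gt0 p0 (ltr0Sn _ 1)).
  have a1 : `|0 - ((M + 1) * p + q)| < `|p| / 2 by apply: HM; rewrite /=; lra.
  have a2 : `|0 - ((M + 2) * p + q)| < `|p| / 2 by apply: HM; rewrite /=; lra.
  have := ler_normB (0 - ((M + 1) * p + q)) (0 - ((M + 2) * p + q)).
  rewrite (_ : _ - _ - _ = p); last by ring.
  lra.
split=> //; apply/eqP; apply: contraT; rewrite -normr_gt0 => q0.
have [M [_ HM]] := H `|q| q0.
by have := HM (M + 1); rewrite /= p0 mulr0 !add0r normrN ltxx ltrDl ltr01 => /(_ isT).
Qed.

Lemma derive1_mx_is_derive (R : realType) (F : R -> 'M[R]_2) (t : R) (D : 'M[R]_2) :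
  mx_is_derive F t D -> F^`()%classic t = D.
Proof.
move=> dF; have dv : derivable F t 1.
  by apply/derivable_mxP => i j; have [] := dF i j.
rewrite derive1E derive_mx //; apply/matrixP => i j; rewrite mxE.
by have [] := dF i j.
Qed.

Lemma mx_is_derive_sub_affine (R : realType) (F : R -> 'M[R]_2) (t : R)
    (D L0 L1 : 'M[R]_2) :
  mx_is_derive F t D -> mx_is_derive (fun s => F s - (s *: L1 + L0)) t (D - L1).
Proof.
move=> dF i j.
have -> : (fun s => (F s - (s *: L1 + L0)) i j) =
    (fun s => F s i j) - (L1 i j *: (id : R -> R) + cst (L0 i j)).
  by apply/funext => s; rewrite !mxE !fctE /GRing.scale /= mulrC.
have dl := is_deriveD (is_deriveZ (L1 i j) (is_derive_id t (1 : R)))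
  (is_derive_cst (L0 i j) t 1).
apply: (is_derive_eq (is_deriveB (dF i j) dl)).
by rewrite !mxE addr0 /GRing.scale /= mulr1.
Qed.

(** The motion [A] approaches the line [t *: Binf + Ainf] in position, velocity
and acceleration, at rates with common constant [C]. The estimates are stated
entry by entry. *)
Definition asymptotic_line (R : realType) (A : R -> 'M[R]_2)
    (Ainf Binf : 'M[R]_2) (C : R) : Prop :=
  forall t, 0 <= t -> forall i j,
    [/\ `|A t i j - (t * Binf i j + Ainf i j)| <= C * (1 + t) ^- 1,
        `|A^`()%classic t i j - Binf i j| <= C * (1 + t) ^- 2 &
        `|A^`(2)%classic t i j| <= C * (1 + t) ^- 3].

Lemma asymptotic_line_ge0 (R : realType) (A : R -> 'M[R]_2)
    (Ainf Binf : 'M[R]_2) (C : R) : asymptotic_line A Ainf Binf C -> 0 <= C.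
Proof.
move=> H; have [h _ _] := H 0 (lexx _) 0 0.
by have := le_trans (normr_ge0 _) h; rewrite addr0 expr1n invr1 mulr1.
Qed.

Lemma solution_asymptotic_line (R : realType) (A : R -> 'M[R]_2) :
  is_solution A -> frob_norm (A t) ^+ 2 @[t --> +oo] --> +oo ->
  exists Ainf Binf C, asymptotic_line A Ainf Binf C.
Proof.
move=> sA Ay; have [C decay] := solution_acceleration_decay sA Ay.
have H (ij : 'I_2 * 'I_2) : exists ab : R * R, forall t, 0 <= t ->
    `|A t ij.1 ij.2 - (t * ab.2 + ab.1)| <= C * (1 + t) ^- 1 /\
    `|A^`()%classic t ij.1 ij.2 - ab.2| <= C * (1 + t) ^- 2.
  have [a [b ab]] := affine_asymptotics
    (fun t _ => solution_is_derive1 t sA ij.1 ij.2)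
    (fun t _ => solution_is_derive2 t sA ij.1 ij.2)
    (fun t t0 => decay t t0 ij.1 ij.2).
  by exists (a, b).
have [ab Hab] := choice H.
exists (\matrix_(i, j) (ab (i, j)).1), (\matrix_(i, j) (ab (i, j)).2), C.
move=> t t0 i j; rewrite !mxE; have [? ?] := Hab (i, j) t t0.
by split=> //; apply: decay.
Qed.

Lemma frob_norm_derive1n_sub_affine (R : realType) (A : R -> 'M[R]_2)
    (Ainf Binf : 'M[R]_2) (C : R) (j : nat) :
  is_solution A -> asymptotic_line A Ainf Binf C ->
  (j <= 2)%N ->
  lesssim_pos
    (fun t => frob_norm ((fun s => A s - (s *: Binf + Ainf))^`(j)%classic t))
    (fun t => (1 + t) ^- j.+1).
Proof.
move=> sA H j2; exists (2 * C) => t t0.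
have C0 := asymptotic_line_ge0 H.
have p0 n : 0 <= C * (1 + t) ^- n.
  by rewrite mulr_ge0 // invr_ge0 exprn_ge0 // addr_ge0 // ltW.
have d1 : (fun s => A s - (s *: Binf + Ainf))^`()%classic =
    (fun s => A^`()%classic s - (s *: 0 + Binf)).
  apply/funext => s; rewrite scaler0 add0r; apply: derive1_mx_is_derive.
  exact/mx_is_derive_sub_affine/solution_is_derive1.
rewrite -mulrA; case: j j2 => [|[|[|//]]] _.
- rewrite derive1n0; apply: frob_norm_le_entries => // i j.
  by have [h _ _] := H t (ltW t0) i j; rewrite !mxE.
- rewrite derive1n1 d1 scaler0 add0r; apply: frob_norm_le_entries => // i j.
  by have [_ h _] := H t (ltW t0) i j; rewrite !mxE.
- rewrite derive1nS derive1n1 d1.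
  rewrite (derive1_mx_is_derive (mx_is_derive_sub_affine _ _ (solution_is_derive2 t sA))).
  rewrite subr0; apply: frob_norm_le_entries => // i j.
  by have [_ _ h] := H t (ltW t0) i j.
Qed.

Lemma frob_norm_cvg0_mx_cvgy0 (R : realType) (F : R -> 'M[R]_2) :
  frob_norm (F t) @[t --> +oo] --> 0 -> mx_cvgy F 0.
Proof.
move=> /cvgrPdist_le H i j; rewrite mxE; apply/cvgrPdist_le => e e0.
move: (H e e0); apply: filterS => t; rewrite !sub0r !normrN; apply: le_trans.
by rewrite -ler_sqr ?nnegrE // !real_normK ?num_real // entry_sqr_le_frob_norm.
Qed.

Lemma asymptotic_line_unique (R : realType) (F : R -> 'M[R]_2)
    (L0 L1 K0 K1 : 'M[R]_2) :
  mx_cvgy (fun t => F t - t *: L1) L0 ->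
  frob_norm (F t - (t *: K1 + K0)) @[t --> +oo] --> 0 -> (K0, K1) = (L0, L1).
Proof.
move=> cL /frob_norm_cvg0_mx_cvgy0 cK.
have H i j : L1 i j - K1 i j = 0 /\ L0 i j - K0 i j = 0.
  apply: affine_cvgy0.
  have -> : (fun t => t * (L1 i j - K1 i j) + (L0 i j - K0 i j)) =
      (fun t => (F t - (t *: K1 + K0)) i j - (F t - t *: L1) i j + L0 i j).
    by apply/funext => t; rewrite !mxE; ring.
  rewrite -[X in _ --> X](subrr (L0 i j)) -[X in _ --> X - _]add0r addrAC.
  have := cvgD (cvgB (cK i j) (cL i j)) (cvg_cst (L0 i j)).
  by rewrite mxE; apply.
congr pair; apply/matrixP => i j; have [h1 h0] := H i j.
- exact/esym/subr0_eq.
- exact/esym/subr0_eq.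
Qed.

(** When the constant [k] vanishes, so does the acceleration. *)
Lemma solution_free (R : realType) (A : R -> 'M[R]_2) :
  is_solution A -> multiplier_constant (A 0) (A^`()%classic 0) = 0 ->
  forall t, A t = t *: A^`()%classic 0 + A 0.
Proof.
move=> sA k0.
have ddA0 t : A^`(2)%classic t = 0.
  apply: frob_norm_eq0; apply/eqP.
  have := solution_acceleration t sA; rewrite k0 mulr0 expr0n /= => /eqP.
  rewrite mulf_eq0 !expf_eq0 /= => /orP[//|/eqP N0].
  by have := solution_frob_norm_ge1 t sA; rewrite N0 expr0n /=; lra.
have dA0 t : A^`()%classic t = A^`()%classic 0.
  apply/matrixP => i j.
  apply: (@is_derive_0_is_cst R (fun s => A^`()%classic s i j)) => s.
  by apply: (is_derive_eq (solution_is_derive2 s sA i j)); rewrite ddA0 mxE.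
move=> t; apply/matrixP => i j; rewrite !mxE.
pose B := A^`()%classic 0.
have : (A t - (t *: B + 0)) i j = (A 0 - (0 *: B + 0)) i j.
  apply: (@is_derive_0_is_cst R (fun s => (A s - (s *: B + 0)) i j)) => s.
  have := mx_is_derive_sub_affine 0 B (solution_is_derive1 s sA) i j.
  by move=> /is_derive_eq; apply; rewrite dA0 subrr mxE.
by rewrite !mxE /B; lra.
Qed.

Theorem theorem12p3 (R : realType) (A : R -> 'M[R]_2) (A0 B0 : 'M[R]_2)
    (hsol : is_solution A)
    (hD : TSL2 (A0, B0))
    (hA0 : A 0 = A0)
    (hB0 : A^`()%classic 0 = B0)
    (hinf : increases_to_infinity (fun t : R => frob_norm (A t) ^+ 2)) :
  exists Ainf Binf : 'M[R]_2,
    [/\ Binf != 0,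
        forall j : nat, (j <= 2)%N ->
          lesssim_pos
            (fun t : R =>
               frob_norm ((fun s : R => A s - (s *: Binf + Ainf))^`(j)%classic t))
            (fun t : R => (1 + t) ^- j.+1) &
        forall Abar Bbar : 'M[R]_2,
          frob_norm (A t - (t *: Bbar + Abar)) @[t --> +oo] --> (0 : R) ->
          (Abar, Bbar) = (Ainf, Binf)] /\
    [/\ X1 Ainf Binf = X1 A0 B0,
        X2 Ainf Binf = X2 A0 B0 &
        X3 Ainf Binf = X3 A0 B0] /\
    [/\ inner Binf (cof Ainf) = 0,
        \det Binf = 0 &
        \det Ainf = (X3 A0 B0 ^+ 2 - X2 A0 B0 ^+ 2) / (2 * X1 A0 B0)] /\
    (2 * X1 A0 B0 + X2 A0 B0 ^+ 2 - X3 A0 B0 ^+ 2 = 0 ->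
       [/\ (Ainf, Binf) = (A0, B0),
           TSL2 (Ainf, Binf) &
           forall t : R, A t = t *: B0 + A0]).
Proof.
have [Ay _] := hinf.
have [Ainf [Binf [C line]]] := solution_asymptotic_line hsol Ay.
have E0 : 0 < X1 A0 B0 by rewrite -hA0 -hB0; apply: solution_energy_gt0.
have C0 := asymptotic_line_ge0 line.
have cA : mx_cvgy (fun t => A t - t *: Binf) Ainf.
  move=> i j; apply/subr_cvg0; apply: (@cvgy_le_inv R _ C) => t t0.
  by have [h _ _] := line t t0 i j; rewrite !mxE -addrA -opprD.
have ctB : mx_cvgy (fun t => t *: (A^`()%classic t - Binf)) 0.
  move=> i j; rewrite mxE; apply: (@cvgy_le_inv R _ C) => t t0.
  have [_ h _] := line t t0 i j; rewrite !mxE normrM ger0_norm //.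
  have p0 : 0 < 1 + t by rewrite ltr_pwDl.
  apply: (@le_trans _ _ ((1 + t) * (C * (1 + t) ^- 2))).
    by apply: ler_pM => //; lra.
  by rewrite le_eqVlt; apply/orP; left; apply/eqP; field; rewrite gt_eqF.
have cB : mx_cvgy A^`()%classic Binf.
  move=> i j; apply/subr_cvg0; apply: (@cvgy_le_inv R _ C) => t t0.
  have [_ h _] := line t t0 i j; apply: le_trans h _.
  have p0 : 0 < 1 + t by rewrite ltr_pwDl.
  rewrite ler_wpM2l // lef_pV2 ?posrE ?exprn_gt0 // expr1 expr2 ler_peMl //; lra.
have unique := fun K0 K1 => @asymptotic_line_unique R A Ainf Binf K0 K1 cA.
have detB : \det Binf = 0.
  have c1 := cvg_inner cB (mx_cvgy_linear (l := @cof R) cB).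
  have N0 t : 0 < frob_norm (A t) ^+ 2.
    exact: lt_le_trans ltr01 (solution_frob_norm_ge1 t hsol).
  have c2 : 2 * multiplier_constant A0 B0 * (frob_norm (A t) ^+ 2)^-1
      @[t --> +oo] --> 2 * multiplier_constant A0 B0 * 0.
    by apply: cvgMl_tmp; apply/gtr0_cvgV0 => //; apply: nearW.
  (* [2 * \det A' = 2 * k / |A| ^+ 2] *)
  have e : (fun t => inner (A^`()%classic t) (cof (A^`()%classic t))) =
      (fun t => 2 * multiplier_constant A0 B0 * (frob_norm (A t) ^+ 2)^-1).
    apply/funext => t; rewrite inner_cof -hA0 -hB0 -(solution_det_derive t hsol).
    by rewrite mulrCA mulrAC divff ?mul1r // gt_eqF.
  rewrite e in c1; have : inner Binf (cof Binf) = 2 * multiplier_constant A0 B0 * 0.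
    by rewrite -(cvg_lim (@Rhausdorff R) c1) -(cvg_lim (@Rhausdorff R) c2).
  by rewrite inner_cof mulr0; lra.
have X1E : X1 Ainf Binf = X1 A0 B0.
  have := cvg_inner cB cB => /(cvgy_cst_eq (c := 2 * X1 A0 B0)).
  rewrite /X1 !frob_norm_sqr => ->; [by lra | move=> t].
  have := solution_X1 t hsol; rewrite hA0 hB0 /X1 !frob_norm_sqr; lra.
have X2E : X2 Ainf Binf = X2 A0 B0.
  have := cvg_bilinear_affine (l := @Zcomm R) (inner_Zcomm Binf) cA cB ctB.
  move=> /(cvgy_cst_eq (c := inner (Zcomm A0) B0)).
  rewrite /X2 -/(Zcomm Ainf) -/(Zcomm A0) => -> // t; rewrite -hA0 -hB0.
  exact: (solution_inner_cst t hsol (@inner_Zcomm R) (@inner_Zcomm_cof R)).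
have X3E : X3 Ainf Binf = X3 A0 B0.
  have := cvg_bilinear_affine (l := @Zanti R) (inner_Zanti Binf) cA cB ctB.
  move=> /(cvgy_cst_eq (c := inner (Zanti A0) B0)).
  rewrite /X3 -/(Zanti Ainf) -/(Zanti A0) => -> // t; rewrite -hA0 -hB0.
  exact: (solution_inner_cst t hsol (@inner_Zanti R) (@inner_Zanti_cof R)).
have tangent : inner Binf (cof Ainf) = 0.
  have BB : inner (cof Binf) Binf = 0 by rewrite innerC inner_cof detB mulr0.
  have := cvg_bilinear_affine (l := @cof R) BB cA cB ctB.
  move=> /(cvgy_cst_eq (c := 0)); rewrite innerC; apply=> t.
  by rewrite innerC solution_tangent.
exists Ainf, Binf; split; [split|split; [split|split; [split|]]] => //.
- apply/eqP => B0'; move: E0; rewrite -X1E B0' /X1 frob_norm_sqr innerE !mxE; lra.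
- by move=> j j2; apply: (frob_norm_derive1n_sub_affine hsol line).
- (* the polynomial identity at the asymptotic pair *)
  have := frob_norm_sqr_det Ainf Binf.
  rewrite detB tangent X1E X2E X3E mulr0 mul0r addr0 => h.
  have E0' : X1 A0 B0 != 0 by rewrite gt_eqF.
  apply: (mulIf E0').
  rewrite [RHS](_ : _ = (X3 A0 B0 ^+ 2 - X2 A0 B0 ^+ 2) / 2); last by field.
  lra.
- move=> h.
  have AE t : A t = t *: B0 + A0.
    rewrite -hA0 -hB0; apply: solution_free => //.
    by rewrite /multiplier_constant hA0 hB0; lra.
  have e : (Ainf, Binf) = (A0, B0).
    apply/esym/unique.
    have -> : (fun t => frob_norm (A t - (t *: B0 + A0))) = cst 0.
      apply/funext => t; rewrite AE subrr /frob_norm innerE !mxE.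
      by rewrite !mulr0 !addr0 sqrtr0.
    exact: cvg_cst.
  by rewrite e.
Qed.
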